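(* Let $\mathcal{A}=(a_{i_1 i_2\cdots i_m})\in\mathbb{R}^{[m,n]}$, let $r_i^+$ ($i\in[n]$) and $\mathcal{B}^+=(b^+_{i_1\cdots i_m})$ be obtained from $\mathcal{A}$ by the decomposition $\mathcal{A}=\mathcal{B}^++\mathcal{C}$ defined in the context, and put $\alpha_j=\left(\frac{\Lambda_j(\mathcal{B}^+)}{|b^+_{jj\cdots j}|}\right)^{\frac{1}{m-1}}$ for $j\in[n]$. Then $\mathcal{A}$ is a $B$-Nekrasov tensor if and only if both of the following conditions hold: (a) $\sum_{(i_2,\dots,i_m)\in[n]^{m-1}} a_{1i_2\cdots i_m}>0$, and $\frac{1}{n^{m-1}}\left(\sum_{(i_2,\dots,i_m)\in[n]^{m-1}} a_{1i_2\cdots i_m}\right)>a_{1j_2\cdots j_m}$ for all $(j_2,\dots,j_m)\in[n]^{m-1}$ with $(j_2,\dots,j_m)\neq(1,\dots,1)$; (b) for every $i\in[n]\setminus\{1\}$, $$r_i^+<\min\left\{\frac{\sum_{(i_2,\dots,i_m)\in[i-1]^{m-1}} a_{ii_2\cdots i_m}\,\alpha_{i_2}\cdots\alpha_{i_m}+\sum_{(i_2,\dots,i_m)\in[n]^{m-1}\setminus[i-1]^{m-1}} a_{ii_2\cdots i_m}}{\sum_{(i_2,\dots,i_m)\in[i-1]^{m-1}}\alpha_{i_2}\cdots\alpha_{i_m}+n^{m-1}-(i-1)^{m-1}},\ a_{ii\cdots i}\right\}.$$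
   Context: $[n]=\{1,\dots,n\}$, and $\mathbb{R}^{[m,n]}$ is the set of real tensors $\mathcal{A}=(a_{i_1\cdots i_m})$ of order $m\ge 2$ and dimension $n$, with each $i_l\in[n]$. The diagonal entries are $a_{ii\cdots i}$; all other entries are off-diagonal. Decomposition: for $\mathcal{A}\in\mathbb{R}^{[m,n]}$ and $i\in[n]$, let $r_i^+=\max\left(\{0\}\cup\{a_{ii_2\cdots i_m}: i_2,\dots,i_m\in[n],\ (i_2,\dots,i_m)\neq(i,\dots,i)\}\right)$. Write $\mathcal{A}=\mathcal{B}^++\mathcal{C}$, where $\mathcal{B}^+=(b^+_{i_1\cdots i_m})$ and $\mathcal{C}=(c_{i_1\cdots i_m})$ have entries $b^+_{ii_2\cdots i_m}=a_{ii_2\cdots i_m}-r_i^+$ and $c_{ii_2\cdots i_m}=r_i^+$ for all $i,i_2,\dots,i_m\in[n]$. For a tensor $\mathcal{T}=(t_{i_1\cdots i_m})$ of order $m$ and dimension $n$ with nonzero diagonal entries, define recursively $\Lambda_1(\mathcal{T})=\sum_{(i_2,\dots,i_m)\neq(1,\dots,1)}|t_{1i_2\cdots i_m}|$ and, for $i=2,\dots,n$, $$\Lambda_i(\mathcal{T})=\sum_{(i_2,\dots,i_m)\in[i-1]^{m-1}}|t_{ii_2\cdots i_m}|\prod_{l=2}^{m}\left(\frac{\Lambda_{i_l}(\mathcal{T})}{|t_{i_li_l\cdots i_l}|}\right)^{\frac1{m-1}}+\sum_{\substack{(i_2,\dots,i_m)\in[n]^{m-1}\setminus[i-1]^{m-1}\\(i_2,\dots,i_m)\neq(i,\dots,i)}}|t_{ii_2\cdots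 i_m}|.$$ $\mathcal{T}$ is a Nekrasov tensor if its diagonal entries are nonzero and $|t_{ii\cdots i}|>\Lambda_i(\mathcal{T})$ for all $i\in[n]$. A $Z$-tensor is a real tensor all of whose off-diagonal entries are nonpositive. A Nekrasov $Z$-tensor is a real tensor that is both a Nekrasov tensor and a $Z$-tensor. $\mathcal{A}\in\mathbb{R}^{[m,n]}$ is a $B$-Nekrasov tensor if, in the decomposition $\mathcal{A}=\mathcal{B}^++\mathcal{C}$ with $b^+_{ii_2\cdots i_m}=a_{ii_2\cdots i_m}-r_i^+$ and $c_{ii_2\cdots i_m}=r_i^+$, $\mathcal{B}^+$ is a Nekrasov $Z$-tensor whose diagonal entries are all positive. Note on well-definedness: $\Lambda_i(\mathcal{B}^+)$ involves only the diagonal entries $b^+_{j\cdots j}$ with $j<i$, and condition (b) for index $i$ involves only $\alpha_j$ with $j<i$. Condition (a) forces $b^+_{1\cdots1}>0$, and condition (b) for index $j$ includes $b^+_{j\cdots j}=a_{j\cdots j}-r_j^+>0$, so the conditions are read successively for $i=1,2,\dots,n$. *)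

(* Defs.v *)
From mathcomp Require Import all_boot all_order all_algebra.
From mathcomp Require Import reals exp.

Set Implicit Arguments.
Unset Strict Implicit.
Unset Printing Implicit Defensive.

Import Order.TTheory GRing.Theory Num.Theory.
Local Open Scope ring_scope.

(* The entry a_{i i_2 ... i_m} of a tensor A of order m >= 2 and dimension n is
   [A i t], where t lists (i_2, ..., i_m).  Indices start at 0: the index i of
   the mathematical text is the ordinal of value i - 1. *)
Definition tensor (R : Type) (m n : nat) : Type :=
  'I_n -> {ffun 'I_m.-1 -> 'I_n} -> R.

Definition diag_idx (m n : nat) (i : 'I_n) : {ffun 'I_m.-1 -> 'I_n} :=
  [ffun=> i].
Arguments diag_idx m {n} i.

Definition diag (R : Type) (m n : nat) (T : tensor R m n) (i : 'I_n) : R :=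
  T i (diag_idx m i).

(* (i_2, ..., i_m) \in [i-1]^(m-1) *)
Definition below (m n : nat) (i : 'I_n) (t : {ffun 'I_m.-1 -> 'I_n}) : bool :=
  [forall l, (t l < i)%N].

Section Nekrasov.
Variables (R : realType) (m n : nat).
Implicit Types (A T : tensor R m n) (i : 'I_n).

Definition Lambda_step T (L : 'I_n -> R) i : R :=
  \sum_(t : {ffun 'I_m.-1 -> 'I_n} | below i t)
     `|T i t| * \prod_l (L (t l) / `|diag T (t l)|) `^ (m.-1%:R^-1)
  + \sum_(t : {ffun 'I_m.-1 -> 'I_n} | ~~ below i t && (t != diag_idx m i))
     `|T i t|.

(* [Lambda_step T L i] only reads L below i, so i + 1 iterations determine the
   value at i whatever the initial function: see [LambdaE] and [Lambda_first]. *)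
Definition Lambda T i : R := iter i.+1 (Lambda_step T) (fun=> 0) i.

Lemma Lambda_step_eq T L1 L2 i :
  (forall j : 'I_n, (j < i)%N -> L1 j = L2 j) ->
  Lambda_step T L1 i = Lambda_step T L2 i.
Proof.
move=> eqL; rewrite /Lambda_step; congr (_ + _).
apply: eq_bigr => t /forallP lt_ti; congr (_ * _).
by apply: eq_bigr => l _; rewrite eqL.
Qed.

Lemma LambdaE T i :
  Lambda T i =
  \sum_(t : {ffun 'I_m.-1 -> 'I_n} | below i t)
     `|T i t| * \prod_l (Lambda T (t l) / `|diag T (t l)|) `^ (m.-1%:R^-1)
  + \sum_(t : {ffun 'I_m.-1 -> 'I_n} | ~~ below i t && (t != diag_idx m i))
     `|T i t|.
Proof.
have iterE k : forall (L1 L2 : 'I_n -> R) p q (j : 'I_n),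
    (j < k)%N -> (j < p)%N -> (j < q)%N ->
    iter p (Lambda_step T) L1 j = iter q (Lambda_step T) L2 j.
  elim: k => // k IHk L1 L2 [|p] [|q] j //= jk jp jq.
  apply: Lambda_step_eq => j' j'j.
  by apply: IHk; apply: leq_trans j'j _.
rewrite [LHS]/Lambda iterS; apply: Lambda_step_eq => j ji.
exact: (iterE n).
Qed.

Lemma Lambda_first T i : (1 < m)%N -> i = 0%N :> nat ->
  Lambda T i = \sum_(t | t != diag_idx m i) `|T i t|.
Proof.
move=> m_gt1 i0; have m1_gt0 : (0 < m.-1)%N by rewrite -subn1 subn_gt0.
have belowF (t : {ffun 'I_m.-1 -> 'I_n}) : below i t = false.
  by apply/forallP => /(_ (Ordinal m1_gt0)); rewrite i0.
rewrite LambdaE big_pred0 // add0r.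
by apply: eq_bigl => t; rewrite belowF.
Qed.

Definition nekrasov T : Prop :=
  (forall i, diag T i != 0) /\ (forall i, Lambda T i < `|diag T i|).

Definition Z_tensor T : Prop :=
  forall i (t : {ffun 'I_m.-1 -> 'I_n}), t != diag_idx m i -> T i t <= 0.

Definition nekrasov_Z T : Prop := nekrasov T /\ Z_tensor T.

Definition rplus A i : R := \big[Num.max/0]_(t | t != diag_idx m i) A i t.

Definition Bplus A : tensor R m n := fun i t => A i t - rplus A i.

Definition B_nekrasov A : Prop :=
  nekrasov_Z (Bplus A) /\ (forall i, 0 < diag (Bplus A) i).

Definition alpha A (j : 'I_n) : R :=
  (Lambda (Bplus A) j / `|diag (Bplus A) j|) `^ (m.-1%:R^-1).

End Nekrasov.

(* Main.v *)
Require Import Defs.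
From mathcomp Require Import all_boot all_order all_algebra.
From mathcomp Require Import reals exp.

(** Subtracting [rplus A i] from row [i] makes every off-diagonal entry of
    [Bplus A] nonpositive, so [Bplus A] is always a Z-tensor and only the strict
    dominance of its rows is at stake.  For the same reason the absolute values
    in [Lambda (Bplus A) i] can be removed by a change of sign, and
    [diag (Bplus A) i - Lambda (Bplus A) i] becomes the sum of the whole row [i]
    of [Bplus A], in which the entry at [t] has weight
    [\prod_l alpha A (t l)] if [t] is below [i] and weight [1] otherwise.
    Expanding [Bplus A i t = A i t - rplus A i], this weighted sum is
    [weighted_sum A i - rplus A i * total_weight A i] ([Bplus_dominance_gap]),
    and the total weight is positive, so dominance of row [i] says precisely
    that [rplus A i] is smaller than the weighted mean of row [i] of [A]
    ([Lambda_Bplus_ltE]).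

    Since [Lambda] is nonnegative, dominance in the form
    [Lambda (Bplus A) i < diag (Bplus A) i] already contains the positivity of
    the diagonal, i.e. [rplus A i < diag A i].  The criterion holds for each row
    separately.  In the first row no index is below, the weighted mean is the
    ordinary one, and exceeding the maximum [rplus A i] means being positive and
    larger than each off-diagonal entry. *)

Import Order.TTheory GRing.Theory Num.Theory.
Local Open Scope ring_scope.

Section RowCriterion.
Variables (R : realType) (m n : nat).
Local Notation idx := {ffun 'I_m.-1 -> 'I_n}.
Implicit Types (A T : tensor R m n) (i : 'I_n) (t : idx).

Definition weighted_sum A i : R :=
  \sum_(t : idx | below i t) A i t * \prod_l alpha A (t l)
  + \sum_(t : idx | ~~ below i t) A i t.

Definition total_weight A i : R :=
  \sum_(t : idx | below i t) \prod_l alpha A (t l)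
  + (n ^ m.-1)%:R - (i ^ m.-1)%:R.

Lemma card_below i : #|[pred t : idx | below i t]| = (i ^ m.-1)%N.
Proof.
have -> : #|[pred t : idx | below i t]|
          = #|[pred t : idx | t \in ffun_on [pred j : 'I_n | (j < i)%N]]|.
  by apply: eq_card => t; apply/forallP/ffun_onP.
rewrite card_ffun_on card_ord; congr (_ ^ _)%N.
by rewrite -sum1_card -(big_ord_widen n (fun=> 1%N) (ltnW (ltn_ord i)))
           sum1_card card_ord.
Qed.

Lemma sum_not_below_const i (x : R) :
  \sum_(t : idx | ~~ below i t) x = ((n ^ m.-1)%:R - (i ^ m.-1)%:R) * x.
Proof.
have all_t : \sum_(t : idx) x = (n ^ m.-1)%:R * x.
  by rewrite sumr_const card_ffun !card_ord mulr_natl.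
rewrite mulrBl -all_t [X in _ = X - _](bigID (below i)) /=.
by rewrite [X in _ = X + _ - _]sumr_const card_below mulr_natl addrAC subrr add0r.
Qed.

Lemma not_below_diag i : (1 < m)%N -> ~~ below i (diag_idx m i).
Proof.
move=> hm; have m1_gt0 : (0 < m.-1)%N by rewrite -subn1 subn_gt0.
by apply/forallP => /(_ (Ordinal m1_gt0)); rewrite ffunE ltnn.
Qed.

Lemma Lambda_ge0 T i : 0 <= Lambda T i.
Proof.
rewrite LambdaE addr_ge0 ?sumr_ge0 // => t _.
by rewrite mulr_ge0 // prodr_ge0 // => l _; apply: powR_ge0.
Qed.

Lemma rplus_ltP A i (x : R) :
  reflect (0 < x /\ forall t, t != diag_idx m i -> A i t < x) (rplus A i < x).
Proof. exact: bigmax_ltP. Qed.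

Lemma Bplus_Z A : Z_tensor (Bplus A).
Proof. by move=> i t ti; rewrite subr_le0; apply: le_bigmax_cond. Qed.

Lemma total_weight_gt0 A i : (1 < m)%N -> 0 < total_weight A i.
Proof.
move=> hm; rewrite /total_weight -addrA; apply: ltr_wpDl.
  by apply: sumr_ge0 => t _; apply: prodr_ge0 => l _; apply: powR_ge0.
by rewrite subr_gt0 ltr_nat ltn_exp2r // -subn1 subn_gt0.
Qed.

(** All entries entering [Lambda (Bplus A) i] are nonpositive, so the left-hand
    side is the weighted sum of the full row [i] of [Bplus A]: the diagonal
    entry is not below [i] and supplies the missing term of weight [1]. *)
Lemma Bplus_dominance_gap A i : (1 < m)%N ->
  diag (Bplus A) i - Lambda (Bplus A) i
  = weighted_sum A i - rplus A i * total_weight A i.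
Proof.
move=> hm; set r := rplus A i.
have absB t : t != diag_idx m i -> - `|Bplus A i t| = A i t - r.
  by move=> ti; rewrite ler0_norm ?opprK //; apply: Bplus_Z.
have below_part :
    - \sum_(t : idx | below i t) `|Bplus A i t| * \prod_l alpha A (t l)
    = \sum_(t : idx | below i t) A i t * \prod_l alpha A (t l)
      - r * \sum_(t : idx | below i t) \prod_l alpha A (t l).
  rewrite mulr_sumr -sumrN -sumrB; apply: eq_bigr => t lt_ti.
  rewrite -mulNr absB ?mulrBl //.
  by apply: contraTneq lt_ti => ->; apply: not_below_diag.
have other_part :
    diag (Bplus A) i
    - \sum_(t : idx | ~~ below i t && (t != diag_idx m i)) `|Bplus A i t|
    = \sum_(t : idx | ~~ below i t) A i t
      - r * ((n ^ m.-1)%:R - (i ^ m.-1)%:R).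
  rewrite [r * _]mulrC -sum_not_below_const -sumrB.
  rewrite [RHS](bigD1 (diag_idx m i)) ?not_below_diag //=.
  congr (_ + _); rewrite -sumrN; apply: eq_bigr => t /andP[_ ti].
  exact: absB.
rewrite LambdaE opprD addrCA other_part below_part /weighted_sum /total_weight.
by rewrite addrACA -opprD -mulrDr addrA.
Qed.

Lemma Lambda_Bplus_ltE A i : (1 < m)%N ->
  (Lambda (Bplus A) i < diag (Bplus A) i)
  = (rplus A i < weighted_sum A i / total_weight A i).
Proof.
move=> hm; rewrite ltr_pdivlMr ?total_weight_gt0 //.
by rewrite -[RHS]subr_gt0 -Bplus_dominance_gap // subr_gt0.
Qed.

(** Being a Z-tensor is automatic for [Bplus A], and a diagonal entry exceeding
    the nonnegative [Lambda] is positive, hence equal to its absolute value. *)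
Lemma B_nekrasovP A :
  B_nekrasov A <-> forall i, Lambda (Bplus A) i < diag (Bplus A) i.
Proof.
split=> [[[[_ domB] _] diagB] i | domB].
  by rewrite -[ltRHS]gtr0_norm.
have diagB i : 0 < diag (Bplus A) i.
  exact: le_lt_trans (Lambda_ge0 _ _) (domB i).
split=> //; split; last exact: Bplus_Z.
by split=> i; rewrite ?gtr0_norm // gt_eqF.
Qed.

Lemma Lambda_Bplus_lt_minE A i : (1 < m)%N ->
  (Lambda (Bplus A) i < diag (Bplus A) i)
  = (rplus A i
     < Num.min (weighted_sum A i / total_weight A i) (diag A i)).
Proof.
move=> hm; rewrite lt_min -Lambda_Bplus_ltE //.
case domB: (_ < _) => //=; symmetry.
rewrite -subr_gt0 -[X in 0 < X]/(diag (Bplus A) i).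
exact: le_lt_trans (Lambda_ge0 _ _) domB.
Qed.

Lemma Lambda_Bplus_lt_first A i : (1 < m)%N -> i = 0%N :> nat ->
  Lambda (Bplus A) i < diag (Bplus A) i <->
  0 < \sum_(t : idx) A i t /\
  (forall t, t != diag_idx m i ->
     A i t < (n ^ m.-1)%:R^-1 * \sum_(s : idx) A i s).
Proof.
move=> hm i0; have m1_gt0 : (0 < m.-1)%N by rewrite -subn1 subn_gt0.
have belowF t : below i t = false.
  by apply/forallP => /(_ (Ordinal m1_gt0)); rewrite i0.
have sumE : weighted_sum A i = \sum_(t : idx) A i t.
  rewrite /weighted_sum big_pred0 // add0r.
  by apply: eq_bigl => t; rewrite belowF.
have weightE : total_weight A i = (n ^ m.-1)%:R.
  by rewrite /total_weight big_pred0 // add0r i0 exp0n // subr0.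
have sum_gt0E : (0 < (n ^ m.-1)%:R^-1 * \sum_(t : idx) A i t)
                 = (0 < \sum_(t : idx) A i t).
  by rewrite pmulr_rgt0 // invr_gt0 -weightE total_weight_gt0.
rewrite Lambda_Bplus_ltE // sumE weightE [_ / _]mulrC -sum_gt0E.
by split=> /rplus_ltP.
Qed.

End RowCriterion.

Theorem theorem3p1 (R : realType) (m n : nat) (hm : (1 < m)%N) (hn : (0 < n)%N)
    (A : tensor R m n) :
  B_nekrasov A <->
  ((0 < \sum_(t : {ffun 'I_m.-1 -> 'I_n}) A (Ordinal hn) t) /\
   (forall s : {ffun 'I_m.-1 -> 'I_n}, s != diag_idx m (Ordinal hn) ->
      A (Ordinal hn) s <
      (n ^ m.-1)%:R^-1 *
        \sum_(t : {ffun 'I_m.-1 -> 'I_n}) A (Ordinal hn) t)) /\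
  (forall i : 'I_n, i != Ordinal hn ->
     rplus A i <
     Num.min
       ((\sum_(t : {ffun 'I_m.-1 -> 'I_n} | below i t)
           A i t * \prod_l alpha A (t l)
         + \sum_(t : {ffun 'I_m.-1 -> 'I_n} | ~~ below i t) A i t)
        / (\sum_(t : {ffun 'I_m.-1 -> 'I_n} | below i t) \prod_l alpha A (t l)
           + (n ^ m.-1)%:R - (i ^ m.-1)%:R))
       (diag A i)).
Proof.
rewrite B_nekrasovP; split=> [domB | [first_row other_rows] i].
  split; first by apply/Lambda_Bplus_lt_first.
  by move=> i _; rewrite -Lambda_Bplus_lt_minE.
have [->|i_neq0] := eqVneq i (Ordinal hn); first by apply/Lambda_Bplus_lt_first.
by rewrite Lambda_Bplus_lt_minE //; apply: other_rows.
Qed.
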